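(* Let $q$ be a prime power and let $\mathscr{S}_T$ be a tangent splash of $\ell_\infty$ in $\mathrm{PG}(2,q^3)$ with centre $T$. Then every order-$q$-subline of $\ell_\infty$ contained in $\mathscr{S}_T$ contains $T$.
   Context: An order-$q$-subplane of $\mathrm{PG}(2,q^3)$ is a subplane of order $q$. An order-$q$-subline of a line is an image of $\mathrm{PG}(1,q)$ under $\mathrm{PGL}(2,q^3)$. If $\pi$ is an order-$q$-subplane meeting the line $\ell_\infty$ in exactly one point $T$, its tangent splash $\mathscr{S}_T$ is the set of $q^2+1$ points of $\ell_\infty$ lying on the extension of some line of $\pi$; $T$ is its centre.
   Formalization: The case q = 2 is excluded: there every three points of the line form an order-2-subline, and a tangent splash has 5 points, so three of the four points other than T form a subline in the splash that misses T. *)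

(* Defs.v *)
From HB Require Import structures.
From mathcomp Require Import all_boot all_order all_algebra.

Set Implicit Arguments.
Unset Strict Implicit.
Unset Printing Implicit Defensive.

Import GRing.Theory VectorInternalTheory.
Local Open Scope ring_scope.

Definition prime_power (q : nat) : Prop :=
  exists p k : nat, [/\ prime p, (0 < k)%N & q = (p ^ k)%N].

(* Over a finite field there are finitely many subspaces, so that sets of      *)
(* points and sets of lines can be taken in {set _}.                           *)
HB.instance Definition _ (F : finFieldType) (V : vectType F) :=
  [Finite of {vspace V} by <:].

(* PG(n, F) is the projective space of 'rV[F]_n.+1.                            *)
Definition point (F : finFieldType) (n : nat) : finType :=
  {U : {vspace 'rV[F]_n.+1} | \dim U == 1%N}.

Definition line (F : finFieldType) (n : nat) : finType :=
  {U : {vspace 'rV[F]_n.+1} | \dim U == 2%N}.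

Definition incident (F : finFieldType) (n : nat)
    (x : point F n) (l : line F n) : bool :=
  (val x <= val l)%VS.

(* The points A and the lines B, with the incidence I, form a projective plane *)
(* of order q.                                                                 *)
Definition projective_plane_of_order (q : nat) (P L : finType)
    (I : P -> L -> bool) (A : {set P}) (B : {set L}) : Prop :=
  [/\ forall x y : P, x \in A -> y \in A -> x != y ->
        exists! l : L, [/\ l \in B, I x l & I y l],
      forall l m : L, l \in B -> m \in B -> l != m ->
        exists! x : P, [/\ x \in A, I x l & I x m],
      exists Q : {set P},
        [/\ Q \subset A, #|Q| = 4
          & forall l : L, l \in B -> (#|[set x in Q | I x l]| <= 2)%N]
    & forall l : L, l \in B -> #|[set x in A | I x l]| = q.+1].

(* A subplane of PG(2, F) is given by its points A and its lines B, each line  *)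
(* being represented by the line of PG(2, F) that extends it.                  *)
Definition subplane (q : nat) (F : finFieldType)
    (A : {set point F 2}) (B : {set line F 2}) : Prop :=
  projective_plane_of_order q (@incident F 2) A B.

Definition splash (F : finFieldType) (linf : line F 2) (B : {set line F 2}) :
    {set point F 2} :=
  [set x | incident x linf && [exists l in B, incident x l]].

Definition tangent_splash (q : nat) (F : finFieldType) (linf : line F 2)
    (T : point F 2) (S : {set point F 2}) : Prop :=
  exists (A : {set point F 2}) (B : {set line F 2}),
    [/\ subplane q A B,
        [set x in A | incident x linf] = [set T]
      & S = splash linf B].

(* K is GF(q), as a subset of F.                                               *)
Definition subfield_of_order (q : nat) (F : finFieldType) (K : {set F}) : Prop :=
  divring_closed K /\ #|K| = q.

(* The canonical PG(n, K) in PG(n, F).                                         *)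
Definition canonical_subgeometry (F : finFieldType) (n : nat) (K : {set F}) :
    {set point F n} :=
  [set x | [exists v : 'rV[F]_n.+1,
     (val x == <[v]>%VS) && [forall i, v 0 i \in K]]].

(* A linear bijection f from 'rV[F]_2 onto l is a coordinatization of l by     *)
(* PG(1, F) composed with an element of PGL(2, F); f ranges over all of them.  *)
Definition subline (q : nat) (F : finFieldType) (l : line F 2)
    (b : {set point F 2}) : Prop :=
  exists (K : {set F}) (f : 'Hom('rV[F]_2, 'rV[F]_3)),
    [/\ subfield_of_order q K,
        lker f = 0%VS /\ limg f = val l
      & b = [set y : point F 2 |
               [exists x in canonical_subgeometry 1 K,
                  val y == (f @: val x)%VS]]].

(* Main.v *)
(** Let [phi x = x ^+ q], so that [phi] has order dividing 3 on GF(q^3) and its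
    fixed field is the only subfield of order [q].  A quadrangle of the subplane
    serves as a frame: the subplane is closed under joining and meeting, so the
    affine coordinates of its points on one side of the frame are closed under
    subtraction and division, and there are [q] of them.  Hence every point and
    every line of the subplane has [phi]-fixed coordinates.

    Suppose that a subline parametrized by [v |-> v *m N] over GF(q) lies in the
    splash and misses [T = tau *m N].  For [w] over GF(q), the point with
    parameter [v] orthogonal to [w] is on a line of the subplane with dual
    coordinates [n], and then [N *m n] is a multiple of [w]; pairing with [tau]
    shows that [n] can be scaled over GF(q) so that [N *m n = w / (tau . w)].
    Since [2 < q], this applies to four pairwise independent [w], namely
    [(1, s_i)] for [i < 3] and [(0, 1)].  The four vectors [n] satisfy a linear
    relation over GF(q), whose image under [N] is a relation
    [\sum_(i < 3) a_i / (omega + s_i) = 0] with [omega] outside GF(q).  This is a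
    quadratic equation for an element of degree 3, so all [a_i] vanish. *)

Require Import Defs.
From HB Require Import structures.
From mathcomp Require Import all_boot all_order all_algebra all_field ring.

Set Implicit Arguments.
Unset Strict Implicit.
Unset Printing Implicit Defensive.

Import GRing.Theory.
Local Open Scope ring_scope.

(** * The subfield of order [q] and the Frobenius power that fixes it *)

Lemma iter_Frobenius_rmorphism (R : comNzRingType) (p k : nat) :
  p \in [pchar R] -> exists phi : {rmorphism R -> R}, phi =1 (fun x => x ^+ (p ^ k)).
Proof.
move=> charR; elim: k => [|k [phi phiE]].
  by exists idfun => x; rewrite expn0 expr1.
exists (pFrobenius_aut charR \o phi) => x /=.
by rewrite pFrobenius_autE phiE -exprM expnSr.
Qed.

(** Multiplication by a nonzero [x] of [K] permutes the nonzero elements of [K]. Their product is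
    nonzero and unchanged, so the factor [x ^+ q.-1] that it picks up is 1. *)
Lemma subfield_expr_card (q : nat) (F : finFieldType) (K : {set F}) x :
  subfield_of_order q K -> x \in K -> x ^+ q = x.
Proof.
move=> [[K1 KB KV] cardK] Kx.
have K0 : 0 \in K by rewrite -(subrr 1) KB.
have KM y z : y \in K -> z \in K -> y * z \in K.
  by move=> Ky Kz; rewrite -[z]invrK KV // -[z^-1]mul1r KV.
have q_gt0 : (0 < q)%N by rewrite -cardK; apply/card_gt0P; exists 0.
have [->|nz_x] := eqVneq x 0; first by rewrite expr0n gtn_eqF.
have cardK' : #|K :\ 0| = q.-1 by rewrite -cardK (cardsD1 0 K) K0.
have imK : [set x * y | y in K :\ 0] = K :\ 0.
  apply/eqP; rewrite eqEcard card_imset; last exact: mulfI.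
  rewrite leqnn andbT; apply/subsetP => _ /imsetP[y /setD1P[nz_y Ky] ->].
  by rewrite !inE mulf_neq0 // KM.
have nz_prod : \prod_(y in K :\ 0) y != 0.
  by apply/prodf_neq0 => y /setD1P[].
suff xq1 : x ^+ q.-1 = 1 by rewrite -(prednK q_gt0) exprS xq1 mulr1.
apply: (mulIf nz_prod); rewrite mul1r -{2}imK big_imset /=; last by move=> ? ? _ _; apply: mulfI.
by rewrite big_split /= prodr_const cardK'.
Qed.

(** The elements of [K] are already [q] roots of ['X^q - 'X], whose degree is [q] because [1 < q];
    there is no room for another root. *)
Lemma mem_subfield_expr_card (q : nat) (F : finFieldType) (K : {set F}) x :
  (1 < q)%N -> subfield_of_order q K -> x ^+ q = x -> x \in K.
Proof.
move=> q_gt1 sfK xq; apply/negPn/negP => xK'.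
have szP : size ('X^q - 'X : {poly F}) = q.+1.
  by rewrite size_polyDl ?size_polyXn // size_polyN size_polyX ltnS.
have nzP : ('X^q - 'X : {poly F}) != 0 by rewrite -size_poly_eq0 szP.
have := max_poly_roots nzP (rs := x :: enum K).
rewrite /= mem_enum xK' enum_uniq szP -cardE sfK.2 ltnn => roots; apply/notF/roots => //.
apply/andP; split; first by rewrite /root !hornerE xq subrr.
apply/allP => y; rewrite mem_enum => Ky.
by rewrite /root !hornerE (subfield_expr_card sfK Ky) subrr.
Qed.

(** * Quadratic relations satisfied by an element that [phi] moves *)

Lemma fixed_quadratic_eq0 (F : fieldType) (phi : {rmorphism F -> F}) (w c0 c1 c2 : F) :
  (forall x, phi (phi (phi x)) = x) -> phi w != w ->
  phi c0 = c0 -> phi c1 = c1 -> phi c2 = c2 ->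
  c0 + c1 * w + c2 * w ^+ 2 = 0 -> [/\ c0 = 0, c1 = 0 & c2 = 0].
Proof.
move=> phi3 w_moved c0K c1K c2K root_w.
pose g := Poly [:: c0; c1; c2].
have gE x : g.[x] = c0 + c1 * x + c2 * x ^+ 2 by rewrite horner_Poly /=; ring.
have rootS x : root g x -> root g (phi x).
  rewrite /root !gE => /eqP/(congr1 phi); rewrite !(rmorphD, rmorphM, rmorph0) /=.
  by rewrite c0K c1K c2K => /eqP.
(* [w], [phi w] and [phi (phi w)] are distinct roots of [g]. *)
have g0 : g = 0.
  apply/eqP/negPn/negP => nz_g.
  have := max_poly_roots nz_g (rs := [:: w; phi w; phi (phi w)]).
  rewrite /= ltnNge (leq_trans (size_Poly _)) // => roots; apply/notF/roots.
    have rw : root g w by rewrite /root gE root_w.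
    by rewrite !rootS ?rw.
  rewrite !inE andbT negb_or eq_sym w_moved /= [phi w == _]eq_sym (inj_eq (fmorph_inj phi)).
  rewrite w_moved andbT.
  by apply: contraNneq w_moved => ephi; rewrite -{2}[w]phi3 -ephi.
have coefg i : [:: c0; c1; c2]`_i = 0 by rewrite -coef_Poly -/g g0 coef0.
by split; [exact: (coefg 0%N)|exact: (coefg 1%N)|exact: (coefg 2%N)].
Qed.

(** Clearing denominators leaves a quadratic in [w] with [phi]-fixed coefficients, which therefore
    all vanish. *)
Lemma fixed_partial_fractions_eq0 (F : fieldType) (phi : {rmorphism F -> F})
    (w s0 s1 s2 a0 a1 a2 : F) :
  (forall x, phi (phi (phi x)) = x) -> phi w != w ->
  phi s0 = s0 -> phi s1 = s1 -> phi s2 = s2 ->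
  s0 != s1 -> s1 != s2 -> s2 != s0 ->
  phi a0 = a0 -> phi a1 = a1 -> phi a2 = a2 ->
  a0 / (w + s0) + a1 / (w + s1) + a2 / (w + s2) = 0 -> [/\ a0 = 0, a1 = 0 & a2 = 0].
Proof.
move=> phi3 w_moved s0K s1K s2K ne01 ne12 ne20 a0K a1K a2K sum0.
have nz s : phi s = s -> w + s != 0.
  move=> sK; apply: contraNneq w_moved => /eqP; rewrite addr_eq0 => /eqP->.
  by rewrite rmorphN sK.
have [[nz0 nz1] nz2] := (nz _ s0K, nz _ s1K, nz _ s2K).
have [||||e0 e1 e2] := @fixed_quadratic_eq0 F phi w
   (a0 * s1 * s2 + a1 * s0 * s2 + a2 * s0 * s1)
   (a0 * (s1 + s2) + a1 * (s0 + s2) + a2 * (s0 + s1)) (a0 + a1 + a2) phi3 w_moved.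
- by rewrite !(rmorphD, rmorphM) /= s0K s1K s2K a0K a1K a2K.
- by rewrite !(rmorphD, rmorphM) /= s0K s1K s2K a0K a1K a2K.
- by rewrite !(rmorphD, rmorphM) /= a0K a1K a2K.
- transitivity ((w + s0) * (w + s1) * (w + s2) *
     (a0 / (w + s0) + a1 / (w + s1) + a2 / (w + s2))); last by rewrite sum0 mulr0.
  by field; rewrite nz0 nz1 nz2.
(* The left side is the cleared numerator evaluated at [- s]; choosing [s] among the [s_i] keeps a
   single term. *)
have eval s : a0 * ((s1 - s) * (s2 - s)) + a1 * ((s0 - s) * (s2 - s)) +
              a2 * ((s0 - s) * (s1 - s)) = 0.
  transitivity ((a0 * s1 * s2 + a1 * s0 * s2 + a2 * s0 * s1)
   - s * (a0 * (s1 + s2) + a1 * (s0 + s2) + a2 * (s0 + s1)) + s ^+ 2 * (a0 + a1 + a2)).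
    by ring.
  by rewrite e0 e1 e2; ring.
have coef0 (a x y s : F) : x != s -> y != s -> a * ((x - s) * (y - s)) = 0 -> a = 0.
  move=> nx ny /eqP; rewrite !mulf_eq0 !subr_eq0 (negPf nx) (negPf ny) !orbF.
  by move/eqP.
split.
- by apply: (coef0 _ s1 s2 s0) => //; [rewrite eq_sym | rewrite -[RHS](eval s0); ring].
- by apply: (coef0 _ s0 s2 s1) => //; [rewrite eq_sym | rewrite -[RHS](eval s1); ring].
- by apply: (coef0 _ s0 s1 s2) => //; [rewrite eq_sym | rewrite -[RHS](eval s2); ring].
Qed.

(** * Homogeneous coordinates and the arithmetic of a frame *)

Definition vec3 (F : finFieldType) (a b c : F) : 'rV[F]_3 := \row_i [:: a; b; c]`_i.

Lemma vec3_linear (F : finFieldType) (k l a b c a' b' c' : F) :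
  k *: vec3 a b c + l *: vec3 a' b' c' =
    vec3 (k * a + l * a') (k * b + l * b') (k * c + l * c').
Proof. by apply/rowP => -[[|[|[|?]]] ?]; rewrite !mxE. Qed.

Lemma vec3Z (F : finFieldType) (k a b c : F) :
  k *: vec3 a b c = vec3 (k * a) (k * b) (k * c).
Proof. by apply/rowP => -[[|[|[|?]]] ?]; rewrite !mxE. Qed.

Lemma vec3_inj (F : finFieldType) (a b c a' b' c' : F) :
  vec3 a b c = vec3 a' b' c' -> [/\ a = a', b = b' & c = c'].
Proof.
move=> /rowP e; split.
- by have := e (Ordinal (isT : 0 < 3)%N); rewrite !mxE.
- by have := e (Ordinal (isT : 1 < 3)%N); rewrite !mxE.
- by have := e (Ordinal (isT : 2 < 3)%N); rewrite !mxE.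
Qed.

Lemma vec3_eq0 (F : finFieldType) (a b c : F) :
  (vec3 a b c == 0) = [&& a == 0, b == 0 & c == 0].
Proof.
have -> : 0 = vec3 0 0 0 :> 'rV[F]_3.
  by apply/rowP => -[[|[|[|?]]] ?]; rewrite !mxE.
apply/eqP/and3P => [/vec3_inj[-> -> ->]|[/eqP-> /eqP-> /eqP->]] //.
Qed.

Lemma vec3E (F : finFieldType) (v : 'rV[F]_3) : exists a b c, v = vec3 a b c.
Proof.
exists (v 0 0), (v 0 1), (v 0 (2%:R)); apply/rowP => i; rewrite mxE.
by case: i => -[|[|[|?]]] lt_i //=; congr (v 0 _); apply: val_inj.
Qed.

(* Independence of the first, third and fourth points already forces the two
   joining lines to exist and to differ: a coincidence of the first two points
   would put the first one on the other line. *)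
Definition meet_closed (F : finFieldType) (P : F -> F -> F -> bool) : Prop :=
  forall (k l m n a b c a1 b1 c1 a2 b2 c2 a3 b3 c3 a4 b4 c4 : F),
  P a1 b1 c1 -> P a2 b2 c2 -> P a3 b3 c3 -> P a4 b4 c4 ->
  a1 * (b3 * c4 - c3 * b4) - b1 * (a3 * c4 - c3 * a4)
    + c1 * (a3 * b4 - b3 * a4) != 0 ->
  ~~ [&& a == 0, b == 0 & c == 0] ->
  vec3 a b c = k *: vec3 a1 b1 c1 + l *: vec3 a2 b2 c2 ->
  vec3 a b c = m *: vec3 a3 b3 c3 + n *: vec3 a4 b4 c4 -> P a b c.

Local Ltac meet_side :=
  solve [ by rewrite !(mul0r, mulr0, mul1r, mulr1, subr0, sub0r, addr0, add0r, oppr0, opprK, oppr_eq0, oner_eq0)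
        | by rewrite ?oner_eq0 ?andbF
        | rewrite vec3_linear; congr vec3; ring ].

(** Von Staudt's constructions: read [P 1 x y] as the affine point [(x, y)], with the last two basis
    points at infinity. Projections and the diagonal carry values between the axes, and further
    intersections subtract and divide them. *)
Lemma meet_closed_coordinates (F : finFieldType) (P : F -> F -> F -> bool) :
  meet_closed P -> ~~ P 0 0 0 ->
  (forall k a b c, k != 0 -> P a b c -> P (k * a) (k * b) (k * c)) ->
  P 1 0 0 -> P 0 1 0 -> P 0 0 1 -> P 1 1 1 ->
  divring_closed [set x | P 1 x 0] /\
  (forall a b c, P a b c ->
     exists2 k, k != 0 & [/\ P 1 (k * a) 0, P 1 (k * b) 0 & P 1 (k * c) 0]).
Proof.
move=> meet P000 scale P100 P010 P001 P111.
have P110 : P 1 1 0.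
  by apply: (meet (-1) 1 1 1 _ _ _ _ _ _ _ _ _ _ _ _ _ _ _ P001 P111 P100 P010); meet_side.
have P011 : P 0 1 1.
  by apply: (meet (-1) 1 1 1 _ _ _ _ _ _ _ _ _ _ _ _ _ _ _ P100 P111 P010 P001); meet_side.
have P101 : P 1 0 1.
  by apply: (meet (-1) 1 1 1 _ _ _ _ _ _ _ _ _ _ _ _ _ _ _ P010 P111 P100 P001); meet_side.
have to_x x y : P 1 x y -> P 1 x 0.
  by move=> Pxy; apply: (meet (- y) 1 1 x _ _ _ _ _ _ _ _ _ _ _ _ _ _ _ P001 Pxy P100 P010); meet_side.
have to_y x y : P 1 x y -> P 1 0 y.
  by move=> Pxy; apply: (meet (- x) 1 1 y _ _ _ _ _ _ _ _ _ _ _ _ _ _ _ P010 Pxy P100 P001); meet_side.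
have x_to_y x : P 1 x 0 -> P 1 0 x.
  move=> Px; apply: (to_y x).
  (* The parallel to the second axis through [(x, 0)] meets the diagonal in [(x, x)]. *)
  by apply: (meet x 1 1 x _ _ _ _ _ _ _ _ _ _ _ _ _ _ _ P001 Px P100 P011); meet_side.
have y_to_x y : P 1 0 y -> P 1 y 0.
  move=> Py; apply: (to_x y y).
  by apply: (meet y 1 1 y _ _ _ _ _ _ _ _ _ _ _ _ _ _ _ P010 Py P100 P011); meet_side.
have pair x y : P 1 x 0 -> P 1 y 0 -> P 1 x y.
  move=> Px /x_to_y Py.
  by apply: (meet y 1 x 1 _ _ _ _ _ _ _ _ _ _ _ _ _ _ _ P001 Px P010 Py); meet_side.
split; first split; rewrite ?inE //.
- move=> x y; rewrite !inE => Px Py; have Pxy := pair x y Px Py.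
  (* The parallel to the diagonal through [(x, y)] meets the first axis at [x - y]. *)
  by apply: (meet (- y) 1 1 (x - y) _ _ _ _ _ _ _ _ _ _ _ _ _ _ _ P011 Pxy P100 P010); meet_side.
- move=> x y; rewrite !inE => Px Py; have Pxy := pair x y Px Py.
  have [->|nz_y] := eqVneq y 0; first by rewrite invr0 mulr0.
  apply: (to_x _ 1).
  (* The line from the origin to [(x, y)] meets the line at height 1 in [(x / y, 1)]. *)
  apply: (meet (1 - y^-1) y^-1 1 (x / y) _ _ _ _ _ _ _ _ _ _ _ _ _ _ _ P100 Pxy P101 P010); try meet_side.
  by rewrite vec3_linear; congr vec3; field.
move=> a b c Pabc.
have [a0|nz_a] := eqVneq a 0; last first.
  have nz_k : a^-1 != 0 by rewrite invr_eq0.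
  exists a^-1 => //; have := scale _ _ _ _ nz_k Pabc; rewrite mulVf // => Pk.
  by split=> //; [apply: (to_x _ _ Pk) | apply/y_to_x/(to_y _ _ Pk)].
rewrite {a}a0 in Pabc *; have [b0|nz_b] := eqVneq b 0; last first.
  have nz_k : b^-1 != 0 by rewrite invr_eq0.
  exists b^-1 => //; have := scale _ _ _ _ nz_k Pabc; rewrite mulVf // mulr0 => Pk.
  split=> //; apply/y_to_x/(to_y 1).
  (* A point at infinity is a slope: the line from the origin in that direction passes through
     [(1, b^-1 * c)], whose second coordinate is then projected. *)
  by apply: (meet (b^-1 * c) 1 1 1 _ _ _ _ _ _ _ _ _ _ _ _ _ _ _ P001 P110 P100 Pk); meet_side.
rewrite {b}b0 in Pabc *.
have nz_c : c != 0 by apply: contraNneq P000 => c0; rewrite c0 in Pabc.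
by exists c^-1; rewrite ?invr_eq0 // mulr0 mulVf.
Qed.

(** * Points and lines as spans of vectors *)

Lemma vlineZ (F : fieldType) (V : vectType F) (k : F) (v : V) :
  k != 0 -> (<[k *: v]> = <[v]>)%VS.
Proof.
move=> nz_k; apply/eqP; rewrite eqEsubv -!memvE memvZ ?memv_line //.
by apply/vlineP; exists k^-1; rewrite scalerA mulVf // scale1r.
Qed.

Lemma point_span (F : finFieldType) n (x : point F n) :
  exists2 u, u != 0 & val x = <[u]>%VS.
Proof.
have dimx := eqP (valP x); have nz_u : vpick (val x) != 0.
  by rewrite vpick0 -dimv_eq0 dimx.
exists (vpick (val x)) => //; apply/esym/eqP.
by rewrite eqEdim -memvE memv_pick dim_vline nz_u dimx.
Qed.

Lemma span_point (F : finFieldType) n (u : 'rV[F]_n.+1) :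
  u != 0 -> exists x : point F n, val x = <[u]>%VS.
Proof.
move=> nz_u; have dimu : \dim <[u]> == 1%N by rewrite dim_vline nz_u.
by exists (Sub <[u]>%VS dimu : point F n).
Qed.

Lemma line_join (F : finFieldType) n (x y : point F n) (l : line F n) :
  x != y -> incident x l -> incident y l -> val l = (val x + val y)%VS.
Proof.
move=> ne_xy xl yl; have [dimx dimy diml] := And3 (eqP (valP x)) (eqP (valP y)) (eqP (valP l)).
apply/esym/eqP; rewrite eqEdim subv_add [(val x <= _)%VS]xl [(val y <= _)%VS]yl diml ltnNge.
apply: contra ne_xy => dim_le; apply/eqP/val_inj/eqP.
have xE : val x == (val x + val y)%VS by rewrite eqEdim addvSl dimx.
by rewrite eq_sym eqEdim (eqP xE) addvSr -(eqP xE) dimx dimy.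
Qed.

Lemma line_unique (F : finFieldType) n (x y : point F n) (l m : line F n) :
  x != y -> incident x l -> incident y l -> incident x m -> incident y m -> l = m.
Proof.
move=> ne xl yl xm ym; apply: val_inj.
by rewrite (line_join ne xl yl) (line_join ne xm ym).
Qed.

Definition spanned (F : finFieldType) n (A : {set point F n}) (u : 'rV[F]_n.+1) : bool :=
  [exists x in A, val x == <[u]>%VS].

Lemma spannedP (F : finFieldType) n (A : {set point F n}) u :
  reflect (exists2 x, x \in A & val x = <[u]>%VS) (spanned A u).
Proof.
apply: (iffP exists_inP) => [[x Ax /eqP]|[x Ax xE]]; exists x => //; exact/eqP.
Qed.

Lemma spanned_neq0 (F : finFieldType) n (A : {set point F n}) u : spanned A u -> u != 0.
Proof. by case/spannedP => x _ xE; have := valP x; rewrite /= xE dim_vline; case: (u != 0). Qed.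

Lemma spannedZ (F : finFieldType) n (A : {set point F n}) k u :
  k != 0 -> spanned A u -> spanned A (k *: u).
Proof.
move=> nz_k /spannedP[x Ax xE]; apply/spannedP; exists x => //.
by rewrite vlineZ.
Qed.

(** * Joins, meets, frame and coordinate field of a subplane *)

Lemma subplane_join q (F : finFieldType) A B (u v : 'rV[F]_3) :
  subplane q A B -> spanned A u -> spanned A v -> <[u]>%VS != <[v]>%VS ->
  exists2 l : line F 2, l \in B & val l = (<[u]> + <[v]>)%VS.
Proof.
move=> [join _ _ _] /spannedP[x Ax xE] /spannedP[y Ay yE] ne.
have ne_xy : x != y by apply: contraNneq ne => xy; rewrite -xE -yE xy.
have [l [[lB xl yl] _]] := join x y Ax Ay ne_xy.
by exists l; rewrite // (line_join ne_xy xl yl) xE yE.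
Qed.

(** The two joins are distinct lines of the subplane, so they share a point of [A]. They also share
    the point spanned by [w], and distinct lines cannot share two points. *)
Lemma subplane_meet q (F : finFieldType) A B (u1 u2 u3 u4 w : 'rV[F]_3) :
  subplane q A B ->
  spanned A u1 -> spanned A u2 -> spanned A u3 -> spanned A u4 ->
  <[u3]>%VS != <[u4]>%VS -> u1 \notin (<[u3]> + <[u4]>)%VS -> w != 0 ->
  w \in (<[u1]> + <[u2]>)%VS -> w \in (<[u3]> + <[u4]>)%VS -> spanned A w.
Proof.
move=> sub A1 A2 A3 A4 ne34 u1_34 nz_w w12 w34.
have [m mB mE] := subplane_join sub A3 A4 ne34.
have ne12 : <[u1]>%VS != <[u2]>%VS.
  apply: contraNneq u1_34 => e12; move: w12; rewrite -e12 addvv => /vlineP[k wE].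
  have nz_k : k != 0 by apply: contraNneq nz_w => k0; rewrite wE k0 scale0r.
  by rewrite -[u1]scale1r -(mulVf nz_k) -scalerA -wE memvZ.
have [l lB lE] := subplane_join sub A1 A2 ne12.
have ne_lm : l != m.
  by apply: contraNneq u1_34 => lm; rewrite -mE -lm lE memvE addvSl.
have [_ meet _ _] := sub; have [z [[Az zl zm] _]] := meet l m lB mB ne_lm.
have [x xE] := span_point nz_w.
have xl : incident x l by rewrite /incident xE lE -memvE.
have xm : incident x m by rewrite /incident xE mE -memvE.
have [zx|ne_zx] := eqVneq z x; first by apply/spannedP; exists z => //; rewrite zx.
by case/eqP: ne_lm; apply: line_unique ne_zx zl xl zm xm.
Qed.

(** The determinant vanishes as soon as the last two points coincide or the first lies on their
    join, and invertibility of [M] brings both situations back to coordinates. *)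
Lemma subplane_meet_closed q (F : finFieldType) A B (M : 'M[F]_3) :
  subplane q A B -> M \in unitmx ->
  meet_closed (fun a b c => spanned A (vec3 a b c *m M)).
Proof.
move=> sub uM k l m n a b c a1 b1 c1 a2 b2 c2 a3 b3 c3 a4 b4 c4 A1 A2 A3 A4 det nz e12 e34.
have injM : injective (mulmx^~ M : 'rV_3 -> 'rV_3) by apply: can_inj (mulmxK uM).
have in_span (x y : 'rV[F]_3) s t : s *: x + t *: y \in (<[x]> + <[y]>)%VS.
  by rewrite memv_add ?memvZ ?memv_line.
apply: subplane_meet sub A1 A2 A3 A4 _ _ _ _ _.
- apply: contraNneq det => e; have : vec3 a3 b3 c3 *m M \in <[vec3 a4 b4 c4 *m M]>%VS.
    by rewrite -e memv_line.
  case/vlineP => s; rewrite scalemxAl => /injM; rewrite vec3Z => /vec3_inj[-> -> ->].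
  by apply/eqP; ring.
- apply: contra det => /memv_addP[_ /vlineP[s ->] [_ /vlineP[t ->]]].
  rewrite !scalemxAl -mulmxDl => /injM; rewrite vec3_linear => /vec3_inj[-> -> ->].
  by apply/eqP; ring.
- rewrite -[0](mul0mx 1 M) (inj_eq injM) vec3_eq0 //.
- by rewrite e12 mulmxDl -!scalemxAl in_span.
- by rewrite e34 mulmxDl -!scalemxAl in_span.
Qed.

Lemma vec3_mul_rows (F : finFieldType) (a b c : F) (u1 u2 u3 : 'rV[F]_3) :
  vec3 a b c *m (\matrix_(i < 3) [:: u1; u2; u3]`_i) = a *: u1 + b *: u2 + c *: u3.
Proof.
by rewrite mulmx_sum_row !big_ord_recl big_ord0 !rowK !mxE /= addr0 addrA.
Qed.

(** A nonzero coefficient in a relation between the rows would put its row in the span of the other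
    two. *)
Lemma noncollinear_unitmx (F : finFieldType) (u1 u2 u3 : 'rV[F]_3) :
  u1 \notin (<[u2]> + <[u3]>)%VS -> u2 \notin (<[u1]> + <[u3]>)%VS ->
  u3 \notin (<[u1]> + <[u2]>)%VS ->
  (\matrix_(i < 3) [:: u1; u2; u3]`_i) \in unitmx.
Proof.
move=> n1 n2 n3; rewrite unitmxE unitfE; apply/det0P => -[v nz_v].
have [a [b [c vE]]] := vec3E v; rewrite {v}vE in nz_v *.
rewrite vec3_mul_rows => rel.
have coef0 k (u v w : 'rV[F]_3) l m :
    u \notin (<[v]> + <[w]>)%VS -> k *: u + (l *: v + m *: w) = 0 -> k = 0.
  move=> nu /eqP; rewrite addr_eq0 => /eqP ku; apply: contraNeq nu => nz_k.
  rewrite -[u]scale1r -(mulVf nz_k) -scalerA ku memvZ // memvN.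
  by rewrite memv_add ?memvZ ?memv_line.
move: nz_v; rewrite vec3_eq0.
rewrite (coef0 a _ _ _ b c n1) ?addrA // (coef0 b _ _ _ a c n2); last by rewrite addrCA addrA.
by rewrite (coef0 c _ _ _ a b n3) ?eqxx // addrC.
Qed.

Lemma card4P (T : finType) (Q : {set T}) : #|Q| = 4 ->
  exists x1 x2 x3 x4, [/\ x1 \in Q, x2 \in Q, x3 \in Q & x4 \in Q] /\ uniq [:: x1; x2; x3; x4].
Proof.
rewrite cardE => sizeQ; have uniqQ := enum_uniq Q; have memQ := mem_enum Q.
case: (enum Q) sizeQ uniqQ memQ => [|x1 [|x2 [|x3 [|x4 [|]]]]] //= _ uniqQ memQ.
by exists x1, x2, x3, x4; split; rewrite // -!memQ !inE !eqxx !orbT.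
Qed.

(** Three points of the quadrangle give a basis. The fourth has only nonzero coordinates in it, as
    no three of the points are collinear, and rescaling the basis by them makes it the unit
    point. *)
Lemma subplane_frame q (F : finFieldType) A B :
  @subplane q F A B -> exists2 M : 'M[F]_3, M \in unitmx &
    [/\ spanned A (vec3 1 0 0 *m M), spanned A (vec3 0 1 0 *m M),
        spanned A (vec3 0 0 1 *m M) & spanned A (vec3 1 1 1 *m M)].
Proof.
move=> sub; have [_ _ [Q [sQA cardQ lineQ]] _] := sub.
have [x1 [x2 [x3 [x4 [[Q1 Q2 Q3 Q4]]]]]] := card4P cardQ.
rewrite /= !inE !negb_or !andbT => /and3P[/and3P[n12 n13 n14] /andP[n23 n24] n34].
have sym (x y : point F 2) : x != y -> y != x by rewrite eq_sym.
have [n21 n31 n32] := And3 (sym _ _ n12) (sym _ _ n13) (sym _ _ n23).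
have [n41 n42 n43] := And3 (sym _ _ n14) (sym _ _ n24) (sym _ _ n34).
have [[u1 nz1 e1] [u2 nz2 e2]] := (point_span x1, point_span x2).
have [[u3 nz3 e3] [u4 nz4 e4]] := (point_span x3, point_span x4).
have span x u : x \in Q -> val x = <[u]>%VS -> spanned A u.
  by move=> /(subsetP sQA) Ax xE; apply/spannedP; exists x.
have noncollinear (x y z : point F 2) u v w : x \in Q -> y \in Q -> z \in Q ->
    val x = <[u]>%VS -> val y = <[v]>%VS -> val z = <[w]>%VS ->
    x != y -> x != z -> y != z -> u \notin (<[v]> + <[w]>)%VS.
  move=> Qx Qy Qz xE yE zE nxy nxz nyz; apply/negP => uvw.
  (* A collinear triple would put three points of [Q] on one line of [B]. *)
  have [|l lB lE] := subplane_join sub (span y v Qy yE) (span z w Qz zE).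
    by rewrite -yE -zE (inj_eq val_inj).
  have: [set x; y; z] \subset [set x in Q | incident x l].
    apply/subsetP => t; rewrite !inE -orbA => /or3P[] /eqP->.
    - by rewrite Qx /incident xE lE -memvE.
    - by rewrite Qy /incident yE lE addvSl.
    - by rewrite Qz /incident zE lE addvSr.
  move=> /subset_leq_card/leq_trans/(_ (lineQ l lB)).
  by rewrite -setUA cardsU1 cards2 !inE nyz (negPf nxy) (negPf nxz).
pose M := \matrix_(i < 3) [:: u1; u2; u3]`_i.
have uM : M \in unitmx.
  apply: noncollinear_unitmx.
  - exact: noncollinear Q1 Q2 Q3 e1 e2 e3 n12 n13 n23.
  - exact: noncollinear Q2 Q1 Q3 e2 e1 e3 n21 n23 n13.
  - exact: noncollinear Q3 Q1 Q2 e3 e1 e2 n31 n32 n12.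
have [a [b [c abcE]]] := vec3E (u4 *m invmx M).
have u4E : u4 = a *: u1 + b *: u2 + c *: u3.
  by rewrite -vec3_mul_rows -/M -abcE mulmxKV.
have nz (k l m : F) u v w : u4 = k *: u + (l *: v + m *: w) ->
    u4 \notin (<[v]> + <[w]>)%VS -> k != 0.
  move=> u4E'; apply: contraNneq => k0; rewrite u4E' k0 scale0r add0r.
  by rewrite memv_add ?memvZ ?memv_line.
have nz_a : a != 0.
  apply: (nz a b c u1 u2 u3); first by rewrite addrA.
  exact: noncollinear Q4 Q2 Q3 e4 e2 e3 n42 n43 n23.
have nz_b : b != 0.
  apply: (nz b a c u2 u1 u3); first by rewrite addrCA addrA.
  exact: noncollinear Q4 Q1 Q3 e4 e1 e3 n41 n43 n13.
have nz_c : c != 0.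
  apply: (nz c a b u3 u1 u2); first by rewrite addrC.
  exact: noncollinear Q4 Q1 Q2 e4 e1 e2 n41 n42 n12.
exists (diag_mx (vec3 a b c) *m M).
  rewrite unitmx_mul uM andbT unitmxE unitfE det_diag !big_ord_recl big_ord0 !mxE /=.
  by rewrite !mulf_neq0 ?oner_eq0.
have scaled x y z : vec3 x y z *m (diag_mx (vec3 a b c) *m M) =
    (x * a) *: u1 + (y * b) *: u2 + (z * c) *: u3.
  rewrite mulmxA mul_mx_diag -vec3_mul_rows; congr (_ *m _).
  by apply/rowP => -[[|[|[|?]]] ?]; rewrite !mxE.
rewrite !scaled !(mul0r, mul1r, scale0r, add0r, addr0) -u4E.
by split; [apply: spannedZ => //; exact: span Q1 e1|apply: spannedZ => //; exact: span Q2 e2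
          |apply: spannedZ => //; exact: span Q3 e3|exact: span Q4 e4].
Qed.

(** The order of [K] is counted on the line joining the first two frame points: of its [q.+1]
    subplane points, all but the second frame point are of the form [(1, r, 0)] with [r] in [K]. *)
Lemma subplane_coordinates q (F : finFieldType) A B :
  @subplane q F A B -> exists (M : 'M[F]_3) (K : {set F}),
    [/\ M \in unitmx, subfield_of_order q K &
        forall x, x \in A -> exists2 v : 'rV[F]_3,
          forall i, v 0 i \in K & val x = <[v *m M]>%VS].
Proof.
move=> sub; have [M uM [A1 A2 A3 A4]] := subplane_frame sub.
have closed := subplane_meet_closed sub uM.
set P := (fun a b c => spanned A (vec3 a b c *m M)) in closed.
have P000 : ~~ P 0 0 0.
  by apply/negP => /spanned_neq0/eqP; apply; rewrite (eqP (_ : vec3 0 0 0 == 0)) ?mul0mx ?vec3_eq0 ?eqxx.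
have scaleP k a b c : k != 0 -> P a b c -> P (k * a) (k * b) (k * c).
  by move=> nz_k Pabc; rewrite /P -vec3Z -scalemxAl spannedZ.
have [closedK coordP] := meet_closed_coordinates closed P000 scaleP A1 A2 A3 A4.
have injM : injective (mulmx^~ M : 'rV_3 -> 'rV_3) by apply: can_inj (mulmxK uM).
exists M, [set x | P 1 x 0]; split => //; last first.
  move=> x Ax; have [u nz_u xE] := point_span x.
  have [a [b [c uE]]] := vec3E (u *m invmx M).
  have uE' : u = vec3 a b c *m M by rewrite -uE mulmxKV.
  have [|k nz_k [Pa Pb Pc]] := coordP a b c.
    by rewrite /P -uE'; apply/spannedP; exists x.
  exists (k *: vec3 a b c).
    rewrite vec3Z => -[[|[|[|i]]] lt_i]; rewrite // !mxE inE; [exact: Pa|exact: Pb|exact: Pc].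
  by rewrite -scalemxAl -uE' xE vlineZ.
split=> //.
pose u r := vec3 1 r 0 *m M; pose w1 := vec3 1 0 0 *m M; pose w2 := vec3 0 1 0 *m M.
have nz_u r : u r != 0.
  by rewrite -[0](mul0mx 1 M) (inj_eq injM) vec3_eq0 oner_eq0.
have dim_u r : \dim <[u r]> == 1%N by rewrite dim_vline nz_u.
pose pt r : point F 2 := Sub <[u r]>%VS (dim_u r).
have ptE r : val (pt r) = <[u r]>%VS by [].
have /spannedP[e1 Ae1 e1E] := A1; have /spannedP[e2 Ae2 e2E] := A2.
have not_e2 r : u r \notin <[w2]>%VS.
  apply/negP => /vlineP[k]; rewrite scalemxAl => /injM; rewrite vec3Z => /vec3_inj[/eqP].
  by rewrite mulr0 oner_eq0.
have ne12 : <[w1]>%VS != <[w2]>%VS.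
  by apply: contraNneq (not_e2 0%R) => <-; rewrite memv_line.
have [l lB lE] := subplane_join sub A1 A2 ne12.
have [_ _ _ card_line] := sub.
have inj_pt : injective pt.
  move=> r s e; have: u r \in <[u s]>%VS by rewrite -ptE -e memv_line.
  case/vlineP => k; rewrite scalemxAl => /injM; rewrite vec3Z => /vec3_inj[].
  by rewrite mulr1 => <- -> _; rewrite mul1r.
suff lineE : [set x in A | incident x l] = e2 |: [set pt r | r in [set r | P 1 r 0]].
  apply: succn_inj; rewrite -(card_line l lB) lineE cardsU1 card_imset // -[LHS]add1n; congr (_ + _)%N.
  apply/eqP; rewrite eq_sym eqb1; apply/imsetP => -[r _ e].
  by have := not_e2 r; rewrite -e2E e ptE memv_line.
apply/setP => x; rewrite !inE; apply/andP/orP => [[Ax xl]|[/eqP->|/imsetP[r]]]; last 2 first.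
- by split; rewrite // /incident e2E lE addvSr.
- rewrite inE => /spannedP[y Ay yE] ->; have -> : pt r = y by apply: val_inj; rewrite ptE yE.
  split=> //; rewrite /incident yE lE -memvE.
  have -> : vec3 1 r 0 = vec3 1 0 0 + r *: vec3 0 1 0.
    by rewrite -[vec3 1 0 0]scale1r vec3_linear; congr vec3; ring.
  by rewrite mulmxDl -scalemxAl memv_add ?memvZ ?memv_line.
have [v nz_v xE] := point_span x.
have : v \in val l by rewrite memvE -xE.
rewrite lE => /memv_addP[_ /vlineP[s ->] [_ /vlineP[t ->] vE]].
have [s0|nz_s] := eqVneq s 0.
  left; apply/eqP/val_inj/eqP; rewrite xE e2E eqEdim !dim_vline nz_v.
  by rewrite (spanned_neq0 A2) andbT -memvE vE s0 scale0r add0r memvZ ?memv_line.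
have sv : s^-1 *: v = u (s^-1 * t).
  rewrite vE !scalemxAl -mulmxDl vec3_linear scalemxAl vec3Z; congr (vec3 _ _ _ *m _); try ring.
  by field.
pose r := s^-1 * t; have xE' : val x = <[u r]>%VS.
  by rewrite xE -sv vlineZ ?invr_eq0.
right; apply/imsetP; exists r; last exact: val_inj.
by rewrite inE; apply/spannedP; exists x.
Qed.

(** * Linear algebra over the fixed field of [phi] *)

Lemma fixed_relation (F : fieldType) (phi : {rmorphism F -> F}) m n (u : 'I_m -> 'cV[F]_n) :
  (n < m)%N -> (forall i, map_mx phi (u i) = u i) ->
  exists a : 'rV[F]_m, [/\ a != 0, map_mx phi a = a & \sum_i a 0 i *: u i = 0].
Proof.
move=> lt_nm uK; pose L := \matrix_(i < m) (u i)^T.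
have LK : map_mx phi L = L by apply/row_matrixP => i; rewrite -map_row !rowK -map_trmx uK.
(* Gaussian elimination commutes with [phi], so [kermx L] is [phi]-fixed. *)
have : kermx L != 0 by rewrite kermx_eq0 /row_free ltn_eqF // (leq_ltn_trans (rank_leq_col _)).
case/matrix0Pn => i [j nz_ij]; exists (row i (kermx L)); split.
- by apply: contraNneq nz_ij => /rowP/(_ j); rewrite !mxE => ->.
- by rewrite map_row map_kermx LK.
- have := row_mul i (kermx L) L; rewrite mulmx_ker row0 mulmx_sum_row => rel.
  apply: trmx_inj; rewrite trmx0 rel linear_sum.
  by apply: eq_bigr => k _; rewrite rowK linearZ.
Qed.

Lemma fixed_relation4 (F : fieldType) (phi : {rmorphism F -> F}) (n0 n1 n2 n3 : 'cV[F]_3) :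
  map_mx phi n0 = n0 -> map_mx phi n1 = n1 -> map_mx phi n2 = n2 -> map_mx phi n3 = n3 ->
  exists a0 a1 a2 a3, [/\ [/\ phi a0 = a0, phi a1 = a1 & phi a2 = a2],
    ~~ [&& a0 == 0, a1 == 0, a2 == 0 & a3 == 0] &
    a0 *: n0 + a1 *: n1 + a2 *: n2 + a3 *: n3 = 0].
Proof.
move=> n0K n1K n2K n3K.
have [||a [nz_a aK rel]] := @fixed_relation F phi 4 3 (fun i => nth n3 [:: n0; n1; n2] i) => //.
  by case=> -[|[|[|[|i]]]] lt_i.
have aiK i : phi (a 0 i) = a 0 i by rewrite -[in RHS]aK mxE.
exists (a 0 0), (a 0 1), (a 0 (2%:R)), (a 0 (3%:R)); split=> //.
  apply: contra nz_a => /and4P[/eqP a0 /eqP a1 /eqP a2 /eqP a3].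
  apply/eqP/rowP => -[[|[|[|[|i]]]] lt_i] //; rewrite mxE;
    [rewrite -[RHS]a0 | rewrite -[RHS]a1 | rewrite -[RHS]a2 | rewrite -[RHS]a3];
    by congr (a _ _); apply: val_inj.
rewrite !big_ord_recl big_ord0 /= addr0 !addrA in rel; rewrite -[RHS]rel.
by congr (_ + _ + _ + _); congr (a _ _ *: _); apply: val_inj.
Qed.

(** Two vectors cannot have full rank 3, so their cokernel is nonzero; like the kernel, it is
    computed compatibly with [phi]. *)
Lemma fixed_normal (F : fieldType) (phi : {rmorphism F -> F}) (v1 v2 : 'rV[F]_3) :
  map_mx phi v1 = v1 -> map_mx phi v2 = v2 ->
  exists n : 'cV[F]_3, [/\ n != 0, map_mx phi n = n, v1 *m n = 0 & v2 *m n = 0].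
Proof.
move=> v1K v2K; pose V := col_mx v1 v2.
have VK : map_mx phi V = V by rewrite map_col_mx v1K v2K.
have : cokermx V != 0 by rewrite cokermx_eq0 /row_full ltn_eqF // (leq_ltn_trans (rank_leq_row _)).
case/matrix0Pn => i [j nz_ij]; exists (col j (cokermx V)).
have /eqP := mulmx_coker V.
rewrite mul_col_mx -[0 in X in X -> _]col_mx0 => /eqP/eq_col_mx[v1n v2n].
split.
- by apply: contraNneq nz_ij => /colP/(_ i); rewrite !mxE => ->.
- by rewrite map_col map_cokermx VK.
- by rewrite colE mulmxA v1n mul0mx.
- by rewrite colE mulmxA v2n mul0mx.
Qed.

(** The line carries [q.+1 >= 2] subplane points, and a fixed normal to the coordinates of two of
    them serves as its dual coordinates. *)
Lemma subplane_fixed_line q (F : finFieldType) (phi : {rmorphism F -> F}) A B (M : 'M[F]_3) l :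
  (0 < q)%N -> @subplane q F A B -> M \in unitmx ->
  (forall x, x \in A -> exists2 v, map_mx phi v = v & val x = <[v *m M]>%VS) -> l \in B ->
  (exists x y, [/\ x \in A, y \in A, x != y, incident x l & incident y l]) /\
  (exists n : 'cV[F]_3, [/\ n != 0, map_mx phi n = n &
     forall z, z *m M \in val l -> z *m n = 0]).
Proof.
move=> q_gt0 [_ _ _ card_line] uM coordA lB.
have [x [y [/[!inE] /andP[Ax xl] /andP[Ay yl] ne]]] : exists x y,
    [/\ x \in [set x in A | incident x l], y \in [set x in A | incident x l] & x != y].
  by apply/card_gt1P; rewrite card_line.
split; first by exists x, y.
have [[v1 v1K v1E] [v2 v2K v2E]] := (coordA x Ax, coordA y Ay).
have [n [nz_n nK v1n v2n]] := fixed_normal v1K v2K; exists n; split=> // z.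
rewrite (line_join ne xl yl) v1E v2E => /memv_addP[_ /vlineP[s ->] [_ /vlineP[t ->]]].
rewrite !scalemxAl -mulmxDl => /(can_inj (mulmxK uM)) ->.
by rewrite mulmxDl -!scalemxAl v1n v2n !scaler0 addr0.
Qed.

(** The order of [F] forces characteristic [p], so the [q]-th power is an iterated Frobenius map;
    its third iterate is [x ^+ #|F|], the identity. *)
Lemma Frobenius_cubic (q : nat) (F : finFieldType) :
  prime_power q -> #|F| = (q ^ 3)%N ->
  exists2 phi : {rmorphism F -> F}, phi =1 (fun x => x ^+ q) & forall x, phi (phi (phi x)) = x.
Proof.
move=> [p [k [p_prime k_gt0 qE]]] cardF.
have charF : p \in [pchar F].
  by apply: (@card_finPcharP _ _ (k * 3)) p_prime; rewrite cardF qE expnM.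
have [phi phiE] := iter_Frobenius_rmorphism k charF.
rewrite -qE in phiE; exists phi => // x.
by rewrite !phiE -!exprM -[RHS]expf_card cardF; congr (x ^+ _); rewrite !expnS expn0; ring.
Qed.

(** * Linear forms on a line and on its parameters *)

(** The two independent rows of [N] lie in the kernel of the nonzero form [n], which also has
    dimension 2, so they span it. *)
Lemma kermx_col_sub (F : fieldType) (N : 'M[F]_(2, 3)) (n : 'cV[F]_3) (z : 'rV[F]_3) :
  row_free N -> n != 0 -> N *m n = 0 -> z *m n = 0 -> (z <= N)%MS.
Proof.
move=> freeN nz_n Nn zn; have zker : (z <= kermx n)%MS by apply/sub_kermxP.
apply: submx_trans zker _; have sNn : (N <= kermx n)%MS by apply/sub_kermxP.
have [_ <-] := mxrank_leqif_sup sNn.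
by rewrite mxrank_ker (eqP freeN) -mxrank_tr rank_rV trmx_eq0 nz_n.
Qed.

Lemma orthogonal_proportional (F : fieldType) (u : 'rV[F]_2) (a b : F) :
  (a != 0) || (b != 0) -> u 0 0 * a + u 0 1 * b = 0 ->
  exists c, u = c *: \row_i [:: b; - a]`_i.
Proof.
move=> nz_ab ub.
have ext c : u 0 0 = c * b -> u 0 1 = c * - a -> u = c *: \row_i [:: b; - a]`_i.
  move=> e0 e1; apply/rowP => -[[|[|i]] lt_i] //; rewrite !mxE /=.
  - by rewrite -e0; congr (u _ _); apply: val_inj.
  - by rewrite -e1; congr (u _ _); apply: val_inj.
have [b0|nz_b] := eqVneq b 0.
  have nz_a : a != 0 by move: nz_ab; rewrite b0 eqxx orbF.
  exists (- (u 0 1 / a)); apply: ext; last by field.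
  by apply: (mulIf nz_a); rewrite b0 mulr0 mul0r -ub b0 mulr0 addr0.
exists (u 0 0 / b); apply: ext; first by field.
apply: (mulIf nz_b); apply/eqP; rewrite -subr_eq0; apply/eqP.
by rewrite -[RHS]ub; field.
Qed.

Theorem theorem7p1 (q : nat) (F : finFieldType)
    (linf : line F 2) (T : point F 2) (S : {set point F 2}) :
  prime_power q -> (2 < q)%N -> #|F| = (q ^ 3)%N ->
  tangent_splash q linf T S ->
  forall b : {set point F 2}, subline q linf b -> b \subset S -> T \in b.
Proof.
move=> q_pp q_gt2 cardF [A [B [sub AT ->]]] b [K [f [sfK [/eqP/lker0P injf imf] bE]]] sbS.
have [phi phiE phi3] := Frobenius_cubic q_pp cardF.
have [M [K' [uM sfK' coordA']]] := subplane_coordinates sub.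
have KP x : x \in K -> phi x = x by rewrite phiE; apply: subfield_expr_card.
have coordA x : x \in A -> exists2 v, map_mx phi v = v & val x = <[v *m M]>%VS.
  move=> /coordA'[v vK' xE]; exists v => //.
  by apply/rowP => i; rewrite mxE phiE; apply: subfield_expr_card sfK' (vK' i).
have lineB := subplane_fixed_line (ltnW (ltnW q_gt2)) sub uM coordA.
(* [N] sends a parameter on [linf] to coordinates in the frame [M]. *)
pose N := lin1_mx f *m invmx M.
have fE v : f v = v *m N *m M by rewrite mulmxA mul_rV_lin1 mulmxKV.
have freeN : row_free N.
  apply: inj_row_free => v vN; apply: injf.
  by rewrite fE vN mul0mx linear0.
have [AT_T linfT] : T \in A /\ incident T linf.
  by have := set11 T; rewrite -AT inE => /andP.
have [t tK TE] := coordA T AT_T.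
have [tau tE] : exists tau, t = tau *m N.
  have : t *m M \in val linf by rewrite memvE -TE.
  rewrite -imf => /memv_imgP[tau _]; rewrite fE => /(can_inj (mulmxK uM)) tE.
  by exists tau.
apply/negPn/negP => bT.
pose pairing (w0 w1 : F) := tau 0 0 * w0 + tau 0 1 * w1.
have [K1 KB KV] := sfK.1.
have K0 : 0 \in K by rewrite -(subrr 1) KB.
have KN x : x \in K -> - x \in K by move=> Kx; rewrite -sub0r KB.
have normal w0 w1 : w0 \in K -> w1 \in K -> (w0 != 0) || (w1 != 0) ->
    pairing w0 w1 != 0 /\ exists n : 'cV[F]_3,
      [/\ n != 0, map_mx phi n = n & (N *m n) 0 0 = w0 / pairing w0 w1].
  move=> Kw0 Kw1 nz_w.
  (* Its entries are in [K], so this vector orthogonal to [(w0, w1)] parametrizes a point of [b]. *)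
  pose v : 'rV[F]_2 := \row_i [:: w1; - w0]`_i.
  have v0 : v 0 0 = w1 by rewrite mxE.
  have v1 : v 0 1 = - w0 by rewrite mxE.
  have nz_v : v != 0.
    by apply: contraTneq nz_w => e; rewrite -[w0]opprK -v1 -v0 e !mxE oppr0 eqxx.
  have nz_fv : f v != 0 by rewrite -(linear0 f) (inj_eq injf).
  have [x xE] := span_point nz_v; have [y yE] := span_point nz_fv.
  have x_can : x \in canonical_subgeometry 1 K.
    rewrite inE; apply/existsP; exists v; rewrite xE eqxx /=; apply/forallP.
    by case=> -[|[|i]] lt_i; rewrite // mxE //= KN.
  have b_y : y \in b.
    by rewrite bE inE; apply/exists_inP; exists x; rewrite // yE xE limg_line.
  have [l lB yl] : exists2 l, l \in B & incident y l.
    by have := subsetP sbS y b_y; rewrite inE => /andP[_ /exists_inP].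
  have [[x1 [x2 [Ax1 Ax2 ne12 x1l x2l]]] [n [nz_n nK ln]]] := lineB l lB.
  have vNn : v *m (N *m n) = 0.
    by rewrite mulmxA ln // -fE memvE -yE.
  set m := N *m n in vNn.
  have vm : w1 * m 0 0 = w0 * m 1 0.
    have /matrixP/(_ 0 0) := vNn; rewrite mxE !big_ord_recl big_ord0 [RHS]mxE.
    rewrite (_ : lift _ _ = 1); last exact: val_inj.
    rewrite v0 v1 addr0 mulNr => /eqP; rewrite subr_eq0 => /eqP //.
  (* If [n] vanished on [linf], the two subplane points on [l] would lie on [linf] and both be
     [T]. *)
  have nz_m : m != 0.
    apply: contra ne12 => /eqP m0.
    have on_linf x' : x' \in A -> incident x' l -> x' = T.
      move=> Ax' x'l; apply/set1P; rewrite -AT inE Ax' /=.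
      have [u nz_u uE] := point_span x'.
      have /submxP[D DE] : (u *m invmx M <= N)%MS.
        apply: (kermx_col_sub freeN nz_n m0); apply: ln.
        by rewrite mulmxKV // memvE -uE.
      rewrite /incident uE -memvE -imf; apply/memv_imgP; exists D; first exact: memvf.
      by rewrite fE -DE mulmxKV.
    by rewrite (on_linf x1) // (on_linf x2).
  (* Otherwise [tau] is a multiple of [v], and [T] is the point [y] of [b]. *)
  have nz_pair : pairing w0 w1 != 0.
    apply: contra bT => /eqP pair0.
    have nz_t : tau != 0.
      apply: contraTneq (valP T) => tau0.
      by rewrite /= TE tE tau0 !mul0mx dim_vline eqxx.
    have [c tauE] := orthogonal_proportional nz_w pair0.
    have nz_c : c != 0 by apply: contraNneq nz_t => c0; rewrite tauE c0 scale0r.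
    suff -> : T = y by [].
    apply: val_inj; rewrite TE tE -fE tauE linearZ /= vlineZ //.
  split=> //.
  (* The scaling factor: [k] is fixed because [t] and [n] are, while proportionality of [m] to
     [(w0, w1)] makes [k] times [(w0, w1)] equal to [pairing w0 w1] times [m]. *)
  pose k := (t *m n) 0 0.
  have kK : phi k = k.
    have : map_mx phi (t *m n) = t *m n by rewrite map_mxM tK nK.
    by move/matrixP/(_ 0 0); rewrite mxE.
  have kE : k = tau 0 0 * m 0 0 + tau 0 1 * m 1 0.
    rewrite /k tE -mulmxA mxE !big_ord_recl big_ord0 addr0.
    by rewrite (_ : lift _ _ = 1) //; exact: val_inj.
  have k0 : k * w0 = pairing w0 w1 * m 0 0.
    by rewrite kE /pairing !mulrDl -!mulrA [m 1 0 * _]mulrC -vm; ring.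
  have k1 : k * w1 = pairing w0 w1 * m 1 0.
    by rewrite kE /pairing !mulrDl -!mulrA [m 0 0 * _]mulrC vm; ring.
  have nz_k : k != 0.
    apply: contra nz_m => /eqP k_0; move: k0 k1; rewrite k_0 !mul0r => /esym/eqP m0 /esym/eqP m1.
    move: m0 m1; rewrite !mulf_eq0 (negPf nz_pair) /= => /eqP m0 /eqP m1.
    apply/eqP/colP => -[[|[|i]] lt_i] //; rewrite [RHS]mxE.
    - by rewrite -[RHS]m0; congr (m _ _); apply: val_inj.
    - by rewrite -[RHS]m1; congr (m _ _); apply: val_inj.
  exists (k^-1 *: n); split.
  - by rewrite scaler_eq0 invr_eq0 negb_or nz_k nz_n.
  - by rewrite map_mxZ fmorphV kK nK.
  - rewrite -scalemxAr mxE -/m; apply: (mulfI nz_k); rewrite mulrA mulfV // mul1r.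
    by rewrite mulrA k0 mulrAC mulfV // mul1r.
have [s0 [s1 [s2 [[Ks0 Ks1 Ks2] [ne01 ne12 ne20]]]]] : exists x y z,
    [/\ x \in K, y \in K & z \in K] /\ [/\ x != y, y != z & z != x].
  by apply/card_gt2P; rewrite sfK.2.
have nz_1 (s : F) : (1 != 0 :> F) || (s != 0) by rewrite oner_eq0.
have [_ [n0 [_ n0K n0E]]] := normal 1 s0 K1 Ks0 (nz_1 _).
have [_ [n1 [_ n1K n1E]]] := normal 1 s1 K1 Ks1 (nz_1 _).
have [_ [n2 [_ n2K n2E]]] := normal 1 s2 K1 Ks2 (nz_1 _).
(* For the weight [(0, 1)] the first entry of [N *m n3] is 0, so [n3] drops out of [sum0] below;
   nonvanishing of the pairing says [tau 0 1 != 0]. *)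
have [|nz_tau1 [n3 [nz_n3 n3K n3E]]] := normal 0 1 K0 K1; first by rewrite oner_eq0 orbT.
rewrite /pairing mulr0 add0r mulr1 in nz_tau1; rewrite mul0r in n3E.
pose w := tau 0 0 / tau 0 1.
(* A fixed [w] would lie in [K], and the weight [(1, - w)] would then have zero pairing with
   [tau]. *)
have w_moved : phi w != w.
  apply/eqP => wK; have Kw : w \in K.
    by apply: mem_subfield_expr_card sfK _; [exact: ltnW | rewrite -phiE].
  have [/eqP nz_pair _] := normal 1 (- w) K1 (KN _ Kw) (nz_1 _); case: nz_pair.
  by rewrite /pairing /w; field.
have [a0 [a1 [a2 [a3 [[a0K a1K a2K] nz_a rel]]]]] := fixed_relation4 n0K n1K n2K n3K.
have nz_w s : s \in K -> w + s != 0.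
  move=> Ks; apply: contraNneq w_moved => /eqP; rewrite addr_eq0 => /eqP->.
  by rewrite KP // KN.
(* This is the first entry of the image of [rel] under [N], multiplied by [tau 0 1], since
   [pairing 1 s] is [tau 0 1 * (w + s)]. *)
have sum0 : a0 / (w + s0) + a1 / (w + s1) + a2 / (w + s2) = 0.
  have := congr1 (fun n => (N *m n) 0 0) rel.
  have entryD (x y : 'cV[F]_3) : (N *m (x + y)) 0 0 = (N *m x) 0 0 + (N *m y) 0 0.
    by rewrite mulmxDr mxE.
  have entryZ k (x : 'cV[F]_3) : (N *m (k *: x)) 0 0 = k * (N *m x) 0 0.
    by rewrite -scalemxAr mxE.
  rewrite !entryD !entryZ n0E n1E n2E n3E mulr0 addr0 mulmx0 mxE => rel0.
  have pairE s : pairing 1 s = tau 0 1 * (w + s) by rewrite /pairing /w; field.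
  rewrite -[RHS](mulr0 (tau 0 1)) -[in RHS]rel0 !pairE.
  by field; rewrite nz_tau1 !nz_w.
have [a0_0 a1_0 a2_0] := fixed_partial_fractions_eq0 phi3 w_moved (KP _ Ks0) (KP _ Ks1) (KP _ Ks2)
  ne01 ne12 ne20 a0K a1K a2K sum0.
(* Only [a3 *: n3 = 0] remains, with both factors nonzero. *)
move: nz_a rel; rewrite a0_0 a1_0 a2_0 eqxx /= !scale0r !add0r => nz_a3 /eqP.
by rewrite scaler_eq0 (negPf nz_a3) (negPf nz_n3).
Qed.
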